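(* Fix a finite state space $S=\{1,\dots,n\}$ with $n\ge 2$, finite nonempty action sets $A(s)$, and a discount factor $\gamma\in(0,1)$, and suppose at least one state has at least two actions. Among strictly positive transition kernels (those $P$ with $P(x\mid s,a)>0$ for all $s,x\in S$, $a\in A(s)$), the kernels $P$ that are not identified by all transition-dependent rewards (i.e. those for which there exists a transition kernel $Q\ne P$ with $Q\equiv_{\mathrm{tr}}P$) lie in a set of Lebesgue measure zero in the usual coordinates on the kernel space.
   Context: A transition kernel $P$ assigns to each $s\in S$, $a\in A(s)$ a row vector $P_{s,a}=P(\cdot\mid s,a)\in\mathbb R^{1\times n}$ with nonnegative entries summing to $1$. Each row has $n-1$ free parameters (e.g. all entries but one), so the kernel space has dimension $D=(n-1)\sum_{s\in S}|A(s)|$; ''usual coordinates'' means these $D$ free parameters, and Lebesgue measure is that of $\mathbb R^D$. A state--action reward is a family of real numbers $r(s,a)$, $s\in S$, $a\in A(s)$. The optimal value $V_{P,r}^*\in\mathbb R^n$ is the unique vector with $V_{P,r}^*(s)=\max_{a\in A(s)}\{r(s,a)+\gamma P_{s,a}V_{P,r}^*\}$ for all $s$, and $\operatorname{Opt}_{P,r}(s)=\arg\max_{a\in A(s)}\{r(s,a)+\gamma P_{s,a}V_{P,r}^*\}$. A transition-dependent reward is a family of real numbers $r(s,a,x)$, $s,x\in S$, $a\in A(s)$ ($x$ being the next state). Under a kernel $P$ it induces the state--action reward $\bar r_P(s,a)=\sum_{x\in S}P(x\mid s,a)r(s,a,x)$, and $\operatorname{Opt}_{P,r}$ means $\operatorname{Opt}_{P,\bar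 r_P}$. $P\equiv_{\mathrm{tr}}Q$ means $\operatorname{Opt}_{P,r}(s)=\operatorname{Opt}_{Q,r}(s)$ for every transition-dependent reward $r$ and every $s\in S$. *)

(* Defs.v *)
From HB Require Import structures.
From mathcomp Require Import all_boot all_order all_algebra.
From mathcomp Require Import all_classical all_reals all_analysis.

Set Implicit Arguments.
Unset Strict Implicit.
Unset Printing Implicit Defensive.

Import Order.TTheory GRing.Theory Num.Theory.
Import numFieldNormedType.Exports.

Local Open Scope classical_set_scope.
Local Open Scope ring_scope.

(* Lebesgue measure on R^D, with R^D realized as D.-tuple R and its product
   sigma-algebra: R^0 carries the unit mass, and R^(D+1) the image of the
   product measure on R^D x R.  Lemma lebesgue_tuple_box gives its value on
   measurable boxes. *)
Section LebesgueTuple.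
Variable R : realType.
Local Notation mR := (measurableTypeR R).

Definition cons_tuple (D : nat) (p : D.-tuple mR * mR) : D.+1.-tuple mR :=
  [tuple of p.2 :: p.1].

Lemma measurable_cons_tuple (D : nat) :
  measurable_fun [set: D.-tuple mR * mR] (@cons_tuple D).
Proof. exact: measurable_cons. Qed.

Section Step.
Context (D : nat) (mu : {measure set (D.-tuple mR) -> \bar R}).

Definition lebesgue_cons : set (D.+1.-tuple mR) -> \bar R :=
  pushforward (mu \x @lebesgue_measure R)%E (@cons_tuple D).

Let lebesgue_cons0 : lebesgue_cons set0 = 0%E.
Proof. by rewrite /lebesgue_cons /pushforward preimage_set0 measure0. Qed.

Let lebesgue_cons_ge0 A : (0 <= lebesgue_cons A)%E.
Proof. by rewrite /lebesgue_cons /pushforward measure_ge0. Qed.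

Let lebesgue_cons_sigma_additive : semi_sigma_additive lebesgue_cons.
Proof.
exact: (@measure_semi_sigma_additive _ _ _
  (measure_function_pushforward__canonical__measure_function_Measure
    _ (@measurable_cons_tuple D))).
Qed.

HB.instance Definition _ := isMeasure.Build _ _ _ lebesgue_cons
  lebesgue_cons0 lebesgue_cons_ge0 lebesgue_cons_sigma_additive.

End Step.

Fixpoint lebesgue_tuple (D : nat) : {measure set (D.-tuple mR) -> \bar R} :=
  if D is D'.+1 then lebesgue_cons (lebesgue_tuple D')
  else \d_([tuple] : 0.-tuple mR).

Lemma lebesgue_tuple_box (D : nat) (B : 'I_D -> set mR) :
  (forall i, measurable (B i)) ->
  lebesgue_tuple D [set t | forall i, B i (tnth t i)] =
  (\prod_(i < D) lebesgue_measure (B i))%E.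
Proof.
elim: D B => [|D IHD] B mB /=.
  rewrite big_ord0 diracE mem_set//= => -[] //.
rewrite /lebesgue_cons /pushforward.
have mB' i : measurable (B (lift ord0 i)) by [].
have -> : @cons_tuple D @^-1` [set t | forall i, B i (tnth t i)] =
    [set t | forall i, B (lift ord0 i) (tnth t i)] `*` B ord0.
  apply/seteqP; split=> -[t x] /=.
    move=> Bt; split=> /= [i|]; last by have := Bt ord0; rewrite tnth0.
    by have := Bt (lift ord0 i); rewrite tnthS.
  move=> [/= Bt Bx] i; have [j ->|->] := unliftP ord0 i.
    by rewrite tnthS.
  by rewrite tnth0.
rewrite product_measure1E//; last first.
  rewrite (_ : mkset _ = \bigcap_(i in [set: 'I_D])
    ((@tnth D mR)^~ i @^-1` B (lift ord0 i))); last first.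
    by apply/seteqP; split=> [t Bt i _|t Bt i]; [exact: Bt|exact: Bt].
  apply: fin_bigcap_measurable => // i _.
  by rewrite -[X in measurable X]setTI; apply: measurable_tnth.
by rewrite (IHD (fun i => B (lift ord0 i)))// big_ord_recl muleC.
Qed.

End LebesgueTuple.

Section MDP.
Variables (R : realType) (n : nat) (A : 'I_n -> finType).

Definition kernel_family := forall s : 'I_n, A s -> 'rV[R]_n.

Definition is_kernel (P : kernel_family) : Prop :=
  forall s (a : A s),
    (forall x, 0 <= P s a 0 x) /\ \sum_(x < n) P s a 0 x = 1.

Definition positive_kernel (P : kernel_family) : Prop :=
  forall s (a : A s) x, 0 < P s a 0 x.

Definition sa_reward := forall s : 'I_n, A s -> R.

Definition trans_reward := forall s : 'I_n, A s -> 'I_n -> R.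

Definition is_max (E : set R) (m : R) : Prop := E m /\ ubound E m.

Definition q_value (gamma : R) (P : kernel_family) (r : sa_reward)
    (V : 'cV[R]_n) (s : 'I_n) (a : A s) : R :=
  r s a + gamma * (P s a *m V) 0 0.

Definition optimality_equation (gamma : R) (P : kernel_family) (r : sa_reward)
    (V : 'cV[R]_n) : Prop :=
  forall s, is_max (range (q_value gamma P r V (s := s))) (V s 0).

(* The optimality equation has exactly one solution when P is a kernel,
   0 < gamma < 1 and every A s is nonempty; the default 0 is irrelevant then. *)
Definition opt_value (gamma : R) (P : kernel_family) (r : sa_reward) :
    'cV[R]_n :=
  xget 0 [set V | optimality_equation gamma P r V].

Definition Opt (gamma : R) (P : kernel_family) (r : sa_reward) (s : 'I_n) :
    set (A s) :=
  [set a | forall b : A s, q_value gamma P r (opt_value gamma P r) b <=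
                           q_value gamma P r (opt_value gamma P r) a].

Definition induced_reward (P : kernel_family) (r : trans_reward) : sa_reward :=
  fun s a => \sum_(x < n) P s a 0 x * r s a x.

Definition tr_equiv (gamma : R) (P Q : kernel_family) : Prop :=
  forall (r : trans_reward) (s : 'I_n),
    @Opt gamma P (induced_reward P r) s = @Opt gamma Q (induced_reward Q r) s.

Definition not_tr_identified (gamma : R) (P : kernel_family) : Prop :=
  exists Q : kernel_family, [/\ is_kernel Q, Q <> P & tr_equiv gamma Q P].

(* Index set of the free parameters: (s, a) together with one of the n - 1
   entries of the row P_{s,a} that are kept. *)
Definition free_param : finType := ({s : 'I_n & A s} * 'I_n.-1)%type.

Lemma card_free_param : #|free_param| = (n.-1 * \sum_(s < n) #|A s|)%N.
Proof. by rewrite card_prod card_tagged card_ord mulnC sumnE big_map big_enum. Qed.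

(* The usual coordinates on the kernel space; omit s a is the entry of the row
   P_{s,a} left out as determined by the others, and lift (omit s a)
   enumerates the remaining n - 1 entries. *)
Definition kernel_coord (omit : forall s : 'I_n, A s -> 'I_n)
    (P : kernel_family) : #|free_param|.-tuple (measurableTypeR R) :=
  [tuple (let c : free_param := enum_val i in
          P (tag c.1) (tagged c.1) 0 (lift (omit (tag c.1) (tagged c.1)) c.2))
   | i < #|free_param|].

End MDP.

(* Main.v *)
(** Fix a state [s0] with two actions [a <> b] and a policy [pi] with
    [pi s0 = a].  Rewards that are very negative off [pi] and [b] reduce the
    optimality question to the tie between [a] and [b], i.e. to the zero set of
    a linear functional of the remaining rewards.  Equivalent kernels have the
    same such zero sets; as rows of kernels sum to 1, the functionals agree.
    The coefficients of the rewards of [b] are the row [P s0 b], so all rows at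
    states with several actions are identified.  The coefficients of the
    rewards of [pi s] are the row [P s (pi s)] times a weight
    [gamma * P_b N e_s - e_{s0} N e_s] with [N = (1 - gamma P_pi)^-1], so that
    row is identified unless the weight vanishes.  The weight is affine in the
    row [P s0 b], and not constant since the column [N e_s] is not constant:
    its zeros form a null set, by Fubini along one coordinate of that row. *)

Require Import Defs.
From HB Require Import structures.
From mathcomp Require Import all_boot all_order all_algebra.
From mathcomp Require Import all_classical all_reals all_analysis.
From mathcomp Require Import measurable_realfun ring lra.

Import Order.TTheory GRing.Theory Num.Theory.

Local Open Scope classical_set_scope.
Local Open Scope ring_scope.

(** * Null sets of Lebesgue measure on tuples *)

(** By uniqueness of the product measure, [\x] agrees with [\x^], which integrates the measures of
    the [y]-sections. *)
Lemma null_of_null_ysections (d1 d2 : measure_display)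
    (T1 : measurableType d1) (T2 : measurableType d2) (R : realType)
    (mu : {sigma_finite_measure set T1 -> \bar R})
    (nu : {sigma_finite_measure set T2 -> \bar R}) (E : set (T1 * T2)) :
  measurable E -> (forall y, mu (ysection E y) = 0%E) -> (mu \x nu)%E E = 0%E.
Proof.
move=> mE E0; transitivity ((mu \x^ nu)%E E).
  by apply: product_measure_unique => // B C mB mC; rewrite /= product_measure2E.
by rewrite [LHS]integral0_eq// => y _ /=; rewrite E0.
Qed.

Lemma lebesgue_tuple_sigma_finite (R : realType) (D : nat) :
  sigma_finite setT (lebesgue_tuple R D).
Proof.
pose box (k : nat) := [set t : D.-tuple (measurableTypeR R) |
  forall i, `[- k%:R, k%:R]%classic (tnth t i)].
exists box.
  apply/esym/seteqP; split=> // t _.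
  pose m i : nat := (Num.truncn `|tnth t i : R|).+1.
  exists (\max_(i < D) m i)%N => //= i.
  rewrite /= in_itv /= -ler_norml.
  by apply/ltW/(lt_le_trans (truncnS_gt _)); rewrite ler_nat (@leq_bigmax _ m i).
move=> k; split.
  rewrite (_ : box k = \bigcap_(i in [set: 'I_D])
    ((@tnth D (measurableTypeR R))^~ i @^-1` `[- k%:R, k%:R]%classic)); last first.
    by apply/seteqP; split=> [t Bt i _|t Bt i]; exact: Bt.
  apply: fin_bigcap_measurable => // i _.
  by rewrite -[X in measurable X]setTI; apply: measurable_tnth.
rewrite /box (lebesgue_tuple_box (B := fun=> _)) // ltey_eq; apply/orP; left.
elim/big_ind : _ => // [x y|i _]; first exact: fin_numM.
by rewrite lebesgue_measure_itv; case: ifP.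
Qed.

(** Each line parallel to axis [i] meets [E] in at most one point, so Fubini applies. If [i] is not
    the head coordinate, fixing the head leaves a thin set in dimension [D], null by induction; if
    it is, fixing the tail leaves at most one point. *)
Lemma lebesgue_tuple_null_of_thin (R : realType) (D : nat) (i : 'I_D)
    (E : set (D.-tuple (measurableTypeR R))) :
  measurable E ->
  (forall t u, E t -> E u -> (forall j, j != i -> tnth t j = tnth u j) ->
     tnth t i = tnth u i) ->
  lebesgue_tuple R D E = 0%E.
Proof.
elim: D i E => [[]//|D IHD] i E mE thinE.
have mE' : measurable (@Defs.cons_tuple R D @^-1` E).
  by rewrite -[X in measurable X]setTI; apply: measurable_cons_tuple.
rewrite /= /lebesgue_cons /pushforward.
have [j ij|i0] := unliftP ord0 i.
  (* [mu] is the same measure packed with its sigma-finiteness, which the exchange of integrals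
     requires. *)
  have sf := lebesgue_tuple_sigma_finite R D.
  pose H1 := isSFinite.Build _ _ _ _ (sfinite_measure_sigma_finite sf).
  pose H2 := isSigmaFinite.Build _ _ _ _ sf.
  pose mu : {sigma_finite_measure set _ -> \bar R} :=
    HB.pack (Measure.sort (lebesgue_tuple R D)) H1 H2.
  apply: (@null_of_null_ysections _ _ _ _ _ mu) => // y.
  apply: (IHD j); first exact: measurable_ysection.
  move=> t u; rewrite /ysection /= !inE /= => Et Eu tu.
  have := thinE _ _ Et Eu; rewrite ij !tnthS; apply=> k.
  have [l -> lj|->] := unliftP ord0 k; last by rewrite !tnth0.
  by rewrite !tnthS tu //; apply: contraNneq lj => ->.
rewrite [LHS]integral0_eq// => t _ /=.
have [[x Ex]|nE] := pselect (exists x, xsection (@Defs.cons_tuple R D @^-1` E) t x).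
  apply: (subset_measure0 _ _ _ (lebesgue_measure_set1 x)) => //.
    exact: measurable_xsection.
  move: Ex; rewrite /xsection /= inE /= => Ex y; rewrite /= inE /= => Ey.
  have := thinE _ _ Ey Ex; rewrite i0 !tnth0 /=; apply=> k.
  by have [l ->|->] := unliftP ord0 k; rewrite ?eqxx// !tnthS.
suff -> : xsection (@Defs.cons_tuple R D @^-1` E) t = set0 by rewrite measure0.
by apply/seteqP; split=> // x Ex; apply: nE; exists x.
Qed.

(** * Optimal values and values of stationary policies *)

Section Policy.
Context {R : realType} {n : nat} {A : 'I_n -> finType}.
Context (gamma : R) (gamma_ge0 : 0 <= gamma) (gamma_lt1 : gamma < 1).
Implicit Types (P Q : kernel_family R A) (V : 'cV[R]_n).

(** Maximum principle: where [d] is maximal its average is at most [d s], so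
    [d s <= gamma * d s]. *)
Lemma discounted_le0 (p : 'I_n -> 'rV[R]_n) (d : 'I_n -> R) :
  (forall s x, 0 <= p s 0 x) -> (forall s, \sum_x p s 0 x = 1) ->
  (forall s, d s <= gamma * \sum_x p s 0 x * d x) -> forall s, d s <= 0.
Proof.
move=> p_ge0 p1 dp s0.
have [s _ ds_max] := @Order.TotalTheory.arg_maxP _ R 'I_n s0 xpredT d isT.
apply: le_trans (ds_max s0 isT) _.
have : d s <= gamma * d s.
  apply: le_trans (dp s) _; apply: ler_wpM2l => //.
  rewrite -[leRHS]mul1r -(p1 s) mulr_suml.
  by apply: ler_sum => x _; apply: ler_wpM2l => //; exact: ds_max.
by rewrite -(@pmulr_rle0 _ (1 - gamma)) ?subr_gt0 //; lra.
Qed.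

Lemma kernel_mulE P s (a : A s) V :
  (P s a *m V) 0 0 = \sum_x P s a 0 x * V x 0.
Proof. by rewrite mxE. Qed.

(** With actions greedy for [V], the difference [V - W] is at most [gamma] times its own average, so
    the maximum principle applies. *)
Lemma optimality_equation_le P (r : sa_reward R A) V W :
  is_kernel P -> optimality_equation gamma P r V ->
  optimality_equation gamma P r W -> forall s, V s 0 <= W s 0.
Proof.
move=> kP optV optW s; rewrite -subr_le0.
have attained s' : exists a : A s', q_value gamma P r V a = V s' 0.
  by have [[a _ <-] _] := optV s'; exists a.
pose a s' := sval (cid (attained s')).
have aE s' : q_value gamma P r V (a s') = V s' 0 := svalP (cid (attained s')).
apply: (@discounted_le0 (fun s => P s (a s)) (fun s => V s 0 - W s 0)) => s'.
- by move=> x; have [/(_ x)] := kP s' (a s').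
- by have [] := kP s' (a s').
have [_ /(_ (q_value gamma P r W (a s')))] := optW s'.
move=> /(_ (imageT _ _)); rewrite -(aE s') /q_value !kernel_mulE => Wle.
under [\sum_x _ * (_ - _)]eq_bigr do rewrite mulrBr.
by rewrite sumrB; lra.
Qed.

Lemma opt_value_unique P (r : sa_reward R A) V :
  is_kernel P -> optimality_equation gamma P r V -> opt_value gamma P r = V.
Proof.
move=> kP optV.
have optW : optimality_equation gamma P r (opt_value gamma P r).
  exact: (@xgetI _ _ [set V | optimality_equation gamma P r V] V).
apply/matrixP => s j; rewrite ord1; apply/eqP; rewrite eq_le.
by rewrite !(@optimality_equation_le P r).
Qed.

Definition bellman_mx P (pi : forall s, A s) : 'M[R]_n :=
  1%:M - gamma *: \matrix_(s, x) P s (pi s) 0 x.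

Lemma bellman_mxE P (pi : forall s, A s) V s :
  (bellman_mx P pi *m V) s 0 = V s 0 - gamma * (P s (pi s) *m V) 0 0.
Proof.
rewrite mulmxBl mul1mx -scalemxAl !mxE; congr (_ - gamma * _).
by apply: eq_bigr => x _; rewrite mxE.
Qed.

(** A null vector equals [gamma] times its own average; the maximum principle applies to it and to
    its negative. *)
Lemma bellman_mx_unit P (pi : forall s, A s) :
  is_kernel P -> bellman_mx P pi \in unitmx.
Proof.
move=> kP; rewrite unitmxE unitfE -det_tr; apply/det0P => -[v vn0 vM0].
move: (f_equal trmx vM0); rewrite trmx_mul trmxK trmx0 => {}vM0.
suff v0 : v^T = 0 by move: vn0; rewrite -[v]trmxK v0 trmx0 eqxx.
have vE s : v^T s 0 = gamma * \sum_x P s (pi s) 0 x * v^T x 0.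
  have /eqP := f_equal (fun B : 'cV[R]_n => B s 0) vM0.
  by rewrite bellman_mxE kernel_mulE [X in _ == X]mxE subr_eq0 => /eqP.
have le0 (e : R) s : e * v^T s 0 <= 0.
  move: s; apply: (@discounted_le0 (fun s => P s (pi s))) => s.
  - by move=> x; have [/(_ x)] := kP s (pi s).
  - by have [] := kP s (pi s).
  rewrite [in leLHS]vE mulrCA [X in _ * X]mulr_sumr.
  by under eq_bigr do rewrite mulrCA.
apply/matrixP => s j; rewrite ord1 [RHS]mxE; apply/eqP; rewrite eq_le.
have := le0 1 s; have := le0 (- 1) s.
by rewrite mulN1r oppr_le0 mul1r => -> ->.
Qed.

(** The value of the stationary policy [pi] when a move from [s] to [x] under [pi s] pays
    [f s x]. *)
Definition policy_value P (pi : forall s, A s) (f : 'I_n -> 'I_n -> R) : 'cV[R]_n :=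
  invmx (bellman_mx P pi) *m \col_s \sum_x P s (pi s) 0 x * f s x.

Lemma policy_valueE P (pi : forall s, A s) f s : is_kernel P ->
  policy_value P pi f s 0 = \sum_x P s (pi s) 0 x * f s x
     + gamma * (P s (pi s) *m policy_value P pi f) 0 0.
Proof.
move=> kP; apply/eqP; rewrite -subr_eq -(bellman_mxE P pi) mulKVmx ?bellman_mx_unit//.
by rewrite mxE.
Qed.

(* The reward makes every action other than b and those of pi too bad to be
   optimal, under any kernel. *)
Definition test_reward (pi : forall s, A s) {s0 : 'I_n} (b : A s0)
    (f : 'I_n -> 'I_n -> R) (g : 'I_n -> R) (M : R) : trans_reward R A :=
  fun s a x => if a == pi s then f s x
    else if Tagged A a == Tagged A b then g x else - M.

(** The advantage of playing [b] once at [s0] and following [pi] afterwards. *)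
Definition tie_gap P (pi : forall s, A s) {s0 : 'I_n} (b : A s0)
    (f : 'I_n -> 'I_n -> R) (g : 'I_n -> R) : R :=
  \sum_x P s0 b 0 x * g x + gamma * (P s0 b *m policy_value P pi f) 0 0
    - policy_value P pi f s0 0.

(** * Test rewards and what their ties identify *)

Section Test.
Context (pi : forall s, A s) {s0 : 'I_n} (b : A s0) (bpi : b != pi s0).

Lemma test_q_value_pi P f g M s : is_kernel P ->
  q_value gamma P (induced_reward P (test_reward pi b f g M))
    (policy_value P pi f) (pi s) = policy_value P pi f s 0.
Proof.
move=> kP; rewrite [RHS]policy_valueE // /q_value /induced_reward.
by congr (_ + _); apply: eq_bigr => x _; rewrite /test_reward eqxx.
Qed.

Lemma test_q_value_b P f g M :
  q_value gamma P (induced_reward P (test_reward pi b f g M))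
    (policy_value P pi f) b = tie_gap P pi b f g + policy_value P pi f s0 0.
Proof.
rewrite /tie_gap subrK /q_value /induced_reward; congr (_ + _).
by apply: eq_bigr => x _; rewrite /test_reward (negbTE bpi) eqxx.
Qed.

(** With [S] the sum of the absolute values of [V], a penalized action is worth at most
    [- M + gamma * S <= - S], which is at most any entry of [V]. *)
Lemma test_optimality_equation P f g M : is_kernel P ->
  2 * (\sum_x `|policy_value P pi f x 0|) <= M ->
  tie_gap P pi b f g <= 0 ->
  optimality_equation gamma P (induced_reward P (test_reward pi b f g M))
    (policy_value P pi f).
Proof.
move=> kP leM gap; set r := induced_reward _ _; set V := policy_value P pi f.
move=> s; split.
  by exists (pi s) => //; exact: test_q_value_pi.
move=> _ [a _ <-].
have [->|api] := eqVneq a (pi s); first by rewrite test_q_value_pi.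
have [/eqP|ab] := boolP (Tagged A a == Tagged A b).
  (* Quantifying over the pair [u] lets the dependent equality with [b] be substituted. *)
  suff qb (u : {s & A s}) : u = Tagged A b ->
    q_value gamma P r V (tagged u) <= V (tag u) 0 by exact: (qb (Tagged A a)).
  by move=> ->; rewrite /= test_q_value_b gerDr.
have [P_ge0 P1] := kP s a.
have rE : r s a = - M.
  rewrite /r /induced_reward /test_reward (negbTE api) (negbTE ab).
  by rewrite -mulr_suml P1 mul1r.
have PV : (P s a *m V) 0 0 <= \sum_x `|V x 0|.
  rewrite kernel_mulE; apply: ler_sum => x _; apply: le_trans (ler_norm _) _.
  rewrite normrM ger0_norm //; apply: ler_piMl => //.
  by rewrite -P1 (bigD1 x) //= lerDl sumr_ge0.
have Vs : - V s 0 <= \sum_x `|V x 0|.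
  rewrite -[leLHS]addr0 (bigD1 s) //= lerD ?sumr_ge0 //.
  by rewrite -normrN ler_norm.
have S0 : 0 <= \sum_x `|V x 0| by apply: sumr_ge0.
have gS : gamma * (\sum_x `|V x 0|) <= \sum_x `|V x 0| by exact/ler_piMl/ltW.
by have := ler_wpM2l gamma_ge0 PV; rewrite /q_value rE; lra.
Qed.

Lemma tie_gapN P f g :
  tie_gap P pi b (fun s x => - f s x) (fun x => - g x) = - tie_gap P pi b f g.
Proof.
have VN : policy_value P pi (fun s x => - f s x) = - policy_value P pi f.
  rewrite /policy_value -mulmxN; congr (_ *m _); apply/matrixP => s j.
  by rewrite !mxE -sumrN; apply: eq_bigr => x _; rewrite mulrN.
rewrite /tie_gap VN mulmxN [in LHS]mxE.
rewrite [(- policy_value P pi f) s0 0]mxE.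
under eq_bigr do rewrite mulrN.
by rewrite sumrN; ring.
Qed.

(* A zero gap under P makes both pi s0 and b optimal at s0, hence also under Q. *)
Lemma tie_gap_eq0_of_le0 P Q f g : is_kernel P -> is_kernel Q ->
  tr_equiv gamma P Q -> tie_gap P pi b f g = 0 -> tie_gap Q pi b f g <= 0 ->
  tie_gap Q pi b f g = 0.
Proof.
move=> kP kQ PQ gapP gapQ.
pose bound K := 2 * (\sum_x `|policy_value K pi f x 0|).
have bound_ge0 K : 0 <= bound K by rewrite mulr_ge0 // sumr_ge0.
(* One reward has to serve both kernels, so the penalty dominates both bounds. *)
pose r := test_reward pi b f g (bound P + bound Q).
have optP : optimality_equation gamma P (induced_reward P r) (policy_value P pi f).
  by apply: test_optimality_equation; rewrite ?gapP // lerDl.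
have optQ : optimality_equation gamma Q (induced_reward Q r) (policy_value Q pi f).
  by apply: test_optimality_equation; rewrite // lerDr.
have VQ := opt_value_unique _ _ _ kQ optQ.
have : Opt gamma P (induced_reward P r) b.
  move=> a; rewrite (opt_value_unique _ _ _ kP optP) test_q_value_b gapP add0r.
  by have [_] := optP s0; apply; exact: imageT.
rewrite PQ => /(_ (pi s0)); rewrite VQ test_q_value_pi // test_q_value_b.
by lra.
Qed.

Lemma tie_gap_eq0 P Q f g : is_kernel P -> is_kernel Q ->
  tr_equiv gamma P Q -> tie_gap P pi b f g = 0 -> tie_gap Q pi b f g = 0.
Proof.
move=> kP kQ PQ gapP.
have [le0|gt0] := leP (tie_gap Q pi b f g) 0.
  exact: (tie_gap_eq0_of_le0 P).
(* A positive gap becomes negative when f and g are negated. *)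
apply: oppr_inj; rewrite -tie_gapN oppr0.
apply: (tie_gap_eq0_of_le0 P) => //; rewrite tie_gapN ?gapP ?oppr0 //.
by rewrite oppr_le0 ltW.
Qed.

(** With [f = 0] the gap is the mean of [g] under the row of [b]; taking for [g] the indicator of
    [x] minus [P s0 b 0 x] gives a tie under [P], and the tie under [Q] equates the entries at
    [x]. *)
Lemma row_eq_of_tr_equiv P Q : is_kernel P -> is_kernel Q ->
  tr_equiv gamma P Q -> Q s0 b = P s0 b.
Proof.
move=> kP kQ PQ; apply/matrixP => i x; rewrite ord1.
have gapE K : is_kernel K ->
    tie_gap K pi b (fun _ _ => 0) (fun y => (y == x)%:R - P s0 b 0 x) =
    K s0 b 0 x - P s0 b 0 x.
  move=> kK; have V0 : policy_value K pi (fun _ _ => 0) = 0.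
    rewrite /policy_value (_ : (\col__ _) = 0) ?mulmx0 //.
    by apply/matrixP => s j; rewrite !mxE big1 // => y _; rewrite mulr0.
  rewrite /tie_gap V0 mulmx0 [X in gamma * X]mxE [X in _ - X]mxE.
  under eq_bigr do rewrite mulrBr.
  rewrite sumrB -mulr_suml (kK s0 b).2 (bigD1 x) //= eqxx big1.
    by rewrite mulr1n; ring.
  by move=> y /negbTE ->; rewrite mulr0.
apply/eqP; rewrite -subr_eq0 -gapE //; apply/eqP.
by apply: (tie_gap_eq0 P) => //; rewrite gapE ?subrr.
Qed.

(** The change in the expected discounted number of plays of [pi s] at [s] when [b] replaces the
    first move from [s0]. *)
Definition gap_weight P (s : 'I_n) : R :=
  gamma * (P s0 b *m invmx (bellman_mx P pi)) 0 s - invmx (bellman_mx P pi) s0 s.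

Lemma tie_gap_delta P s x c : is_kernel P ->
  tie_gap P pi b (@delta_mx R n n s x) (fun=> c) =
  c + P s (pi s) 0 x * gap_weight P s.
Proof.
move=> kP; have VE : policy_value P pi (@delta_mx R n n s x) =
    P s (pi s) 0 x *: (invmx (bellman_mx P pi) *m delta_mx s 0).
  rewrite /policy_value scalemxAr; congr (_ *m _).
  apply/matrixP => s' j; rewrite !mxE ord1 andbT (bigD1 x) //= big1.
    by rewrite mxE eqxx andbT addr0; have [->|] := eqVneq s' s; rewrite ?mulr0.
  by move=> y /negbTE yx; rewrite mxE yx andbF mulr0.
rewrite /tie_gap VE -mulr_suml (kP s0 b).2 -scalemxAr mulmxA -!colE /gap_weight.
by rewrite !mxE; ring.
Qed.

(** A constant reward for [b] cancelling the gap under [P] shows that the products of entry and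
    weight agree. Summing over [x] equates the weights, which then cancel. *)
Lemma other_row_eq_of_tr_equiv P Q s : is_kernel P -> is_kernel Q ->
  tr_equiv gamma P Q -> gap_weight P s != 0 -> Q s (pi s) = P s (pi s).
Proof.
move=> kP kQ PQ w0.
have rowE x : Q s (pi s) 0 x * gap_weight Q s = P s (pi s) 0 x * gap_weight P s.
  have : tie_gap Q pi b (@delta_mx R n n s x)
      (fun=> - (P s (pi s) 0 x * gap_weight P s)) = 0.
    by apply: (tie_gap_eq0 P) => //; rewrite tie_gap_delta // addNr.
  by rewrite tie_gap_delta // => /eqP; rewrite addrC subr_eq0 => /eqP.
have wE : gap_weight Q s = gap_weight P s.
  rewrite -[LHS]mul1r -[RHS]mul1r -{1}(kQ s (pi s)).2 -(kP s (pi s)).2.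
  by rewrite !mulr_suml; apply: eq_bigr => x _; exact: rowE.
apply/matrixP => i x; rewrite ord1.
by move: (rowE x); rewrite wE; exact: mulIf.
Qed.

(* The determinant of bellman_mx times the gap weight: a polynomial in the
   entries of P, affine in the row of b. *)
Definition scaled_weight P (s : 'I_n) : R :=
  gamma * (P s0 b *m \adj (bellman_mx P pi)) 0 s - \adj (bellman_mx P pi) s0 s.

Lemma scaled_weight_eq0 P s : is_kernel P ->
  gap_weight P s = 0 -> scaled_weight P s = 0.
Proof.
move=> kP w0; have uP := bellman_mx_unit P pi kP.
have detP : \det (bellman_mx P pi) != 0 by rewrite -unitfE -unitmxE.
have -> : scaled_weight P s = \det (bellman_mx P pi) * gap_weight P s.
  have scaleE p q k (B : 'M[R]_(p, q)) i j : (k *: B) i j = k * B i j.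
    by rewrite mxE.
  by rewrite /gap_weight /scaled_weight /invmx uP -scalemxAr !scaleE; field.
by rewrite w0 mulr0.
Qed.

End Test.

(** [bellman_mx] maps a constant column [k] to the constant [(1 - gamma) * k], but it maps column
    [s] of its adjugate to the determinant at [s] and 0 at other states. As another state exists,
    the determinant would vanish. *)
Lemma adj_bellman_mx_col_nonconstant P (pi : forall s, A s) s y0 :
  is_kernel P -> (2 <= n)%N -> exists y,
  \adj (bellman_mx P pi) y s != \adj (bellman_mx P pi) y0 s.
Proof.
move=> kP n2; apply/existsP; apply: contraT; rewrite negb_exists => /forallP adjE.
set k := \adj (bellman_mx P pi) y0 s.
have adj_colE y : \adj (bellman_mx P pi) y s = k by apply/eqP; move: (adjE y); rewrite negbK.
have rowE y : (1 - gamma) * k = \det (bellman_mx P pi) *+ (y == s).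
  transitivity ((bellman_mx P pi *m \adj (bellman_mx P pi)) y s).
    transitivity ((bellman_mx P pi *m col s (\adj (bellman_mx P pi))) y 0).
      rewrite bellman_mxE kernel_mulE mxE adj_colE.
      rewrite (eq_bigr (fun x => P y (pi y) 0 x * k)) => [|x _].
        by rewrite -mulr_suml (kP y (pi y)).2; ring.
      by rewrite mxE adj_colE.
    by rewrite colE mulmxA -colE mxE.
  by rewrite mul_mx_adj mxE.
have [y ys] : exists y, y != s.
  have /card_gt0P[y ys] : (0 < #|predC1 s|)%N.
    by rewrite cardC1 card_ord; case: (n) n2 => [|[]].
  by exists y.
have := bellman_mx_unit P pi kP; rewrite unitmxE unitfE.
have := rowE s; rewrite eqxx mulr1n => <-.
by rewrite (rowE y) (negbTE ys) mulr0n eqxx.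
Qed.

End Policy.

(** * Measurability of determinants and adjugates *)

Lemma measurable_fun_det (d : measure_display) (T : measurableType d)
    (R : realType) (m : nat) (D : set T) (B : T -> 'M[R]_m) :
  (forall i j, measurable_fun D (fun t => B t i j)) ->
  measurable_fun D (fun t => \det (B t)).
Proof.
move=> mB; apply: measurable_sum => sigma.
apply: measurable_funM; first exact: measurable_cst.
exact: measurable_prod.
Qed.

Lemma measurable_fun_adj (d : measure_display) (T : measurableType d)
    (R : realType) (m : nat) (D : set T) (B : T -> 'M[R]_m) (i j : 'I_m) :
  (forall i j, measurable_fun D (fun t => B t i j)) ->
  measurable_fun D (fun t => \adj (B t) i j).
Proof.
move=> mB; under eq_fun do rewrite mxE.
apply: measurable_funM; first exact: measurable_cst.
apply: measurable_fun_det => k l.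
by under eq_fun do rewrite !mxE; exact: mB.
Qed.

(** * Kernels in coordinates and the exceptional null sets *)

Section Coordinates.
Context {R : realType} {n : nat} {A : 'I_n -> finType}.
Context (omit : forall s : 'I_n, A s -> 'I_n).
Local Notation D := #|free_param A|.
Implicit Types (t u : D.-tuple (measurableTypeR R)).

Definition param_index {s} (a : A s) (j : 'I_n.-1) : 'I_D :=
  enum_rank ((Tagged A a, j) : free_param A).

(** Defined on all of the coordinate space: rows always sum to 1 but may have negative entries. *)
Definition kernel_of_coord (t : D.-tuple (measurableTypeR R)) : kernel_family R A :=
  fun s a => \row_x
    if unlift (omit s a) x is Some j then tnth t (param_index a j)
    else 1 - \sum_j (tnth t (param_index a j) : R).

Lemma kernel_of_coordK (P : kernel_family R A) :
  is_kernel P -> kernel_of_coord (kernel_coord omit P) = P.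
Proof.
move=> kP; apply/functional_extensionality_dep => s.
apply/funext => a; apply/matrixP => i x; rewrite ord1 mxE.
have coordE j : tnth (kernel_coord omit P) (param_index a j) =
    P s a 0 (lift (omit s a) j).
  by rewrite tnth_mktuple enum_rankK.
case: unliftP => [j ->|->]; first exact: coordE.
under eq_bigr do rewrite coordE.
by rewrite -(kP s a).2 (bigD1_ord (omit s a)) //= addrK.
Qed.

(** Eliminating the omitted entry exhibits the slope in each free parameter. *)
Lemma kernel_of_coord_sum t s (a : A s) (c : 'I_n -> R) :
  \sum_x kernel_of_coord t s a 0 x * c x =
  c (omit s a) + \sum_j (tnth t (param_index a j) : R) *
                   (c (lift (omit s a) j) - c (omit s a)).
Proof.
rewrite (bigD1_ord (omit s a)) //= mxE unlift_none.
under eq_bigr do rewrite mxE liftK.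
under [in RHS]eq_bigr do rewrite mulrBr.
by rewrite sumrB -mulr_suml; ring.
Qed.

Lemma measurable_kernel_of_coord s (a : A s) x :
  measurable_fun setT (fun t => kernel_of_coord t s a 0 x).
Proof.
under eq_fun do rewrite mxE.
case: unliftP => [j _|_]; first exact: measurable_tnth.
apply: measurable_funB; first exact: measurable_cst.
by apply: measurable_sum => j; exact: measurable_tnth.
Qed.

Context (gamma : R) (gamma_gt0 : 0 < gamma) (pi : forall s, A s).
Context {s0 : 'I_n} (b : A s0) (bpi : b != pi s0).

(** The inequality says that the scaled weight of state [c.1] has nonzero slope in the free
    parameter [c.2] of the row of [b]. *)
Definition degenerate_coord (c : 'I_n * 'I_n.-1) :
    set (D.-tuple (measurableTypeR R)) :=
  [set t | scaled_weight gamma pi b (kernel_of_coord t) c.1 = 0 /\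
     \adj (bellman_mx gamma (kernel_of_coord t) pi) (lift (omit s0 b) c.2) c.1
     != \adj (bellman_mx gamma (kernel_of_coord t) pi) (omit s0 b) c.1].

Lemma measurable_degenerate_coord c : measurable (degenerate_coord c).
Proof.
have madj i j : measurable_fun setT
    (fun t => \adj (bellman_mx gamma (kernel_of_coord t) pi) i j).
  apply: measurable_fun_adj => k l.
  under eq_fun do rewrite 5!mxE.
  apply: measurable_funB; first exact: measurable_cst.
  apply: measurable_funM; first exact: measurable_cst.
  exact: measurable_kernel_of_coord.
have mweight : measurable_fun setT
    (fun t => scaled_weight gamma pi b (kernel_of_coord t) c.1).
  rewrite /scaled_weight; under eq_fun do rewrite [(_ *m _) 0 _]mxE.
  apply: measurable_funB => //.
  apply: measurable_funM; first exact: measurable_cst.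
  apply: measurable_sum => y; apply: measurable_funM => //.
  exact: measurable_kernel_of_coord.
apply: measurableI; rewrite -[X in measurable X]setTI.
  exact: (mweight measurableT [set 0] (measurable_set1 0)).
have mneq := measurable_neg (measurable_fun_eqr
  (madj (lift (omit s0 b) c.2) c.1) (madj (omit s0 b) c.1)).
exact: (mneq measurableT [set true] Logic.I).
Qed.

(** As [b] differs from [pi s0], the adjugate does not depend on the row of [b]. Along the chosen
    parameter the scaled weight is thus affine with nonzero slope and has at most one zero. *)
Lemma degenerate_coord_null c : lebesgue_tuple R D (degenerate_coord c) = 0%E.
Proof.
apply: (lebesgue_tuple_null_of_thin _ _ (param_index b c.2)).
  exact: measurable_degenerate_coord.
move=> t u [wt slope] [wu _] tu.
have bellmanE : bellman_mx gamma (kernel_of_coord t) pi =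
    bellman_mx gamma (kernel_of_coord u) pi.
  have coordE s j : tnth t (param_index (pi s) j) = tnth u (param_index (pi s) j).
    apply: tu; apply: contraNneq bpi => /enum_rank_inj /(f_equal fst) /= E.
    (* The test of agreeing with [pi] makes sense on pairs and separates [pi s] from [b] without
       transporting actions between states. *)
    by have := f_equal (fun v : {s & A s} => tagged v == pi (tag v)) E; rewrite /= eqxx => <-.
  congr (_ - _ *: _); apply/matrixP => s x; rewrite !mxE.
  case: unliftP => [j _|_]; first exact: coordE.
  by congr (1 - _); apply: eq_bigr => j _; exact: coordE.
have sumE := kernel_of_coord_sum _ s0 b
  (fun y => \adj (bellman_mx gamma (kernel_of_coord t) pi) y c.1).
move: wt wu; rewrite /scaled_weight -bellmanE ![(_ *m _) 0 _]mxE.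
rewrite !sumE !(bigD1 c.2 isT) /=.
have sumtu F : \sum_(j | j != c.2) (tnth t (param_index b j) : R) * F j =
    \sum_(j | j != c.2) (tnth u (param_index b j) : R) * F j :> R.
  apply: eq_bigr => j jc; rewrite tu //.
  by apply: contraNneq jc => /enum_rank_inj /(f_equal snd) /= ->.
rewrite sumtu => wt wu; rewrite -subr_eq0 in slope.
by apply: (mulfI (mulf_neq0 (lt0r_neq0 gamma_gt0) slope)); lra.
Qed.

End Coordinates.

Theorem proposition4p4 (R : realType) (n : nat) (hn : (2 <= n)%N)
    (A : 'I_n -> finType) (hA : forall s, (0 < #|A s|)%N)
    (gamma : R) (hgamma0 : 0 < gamma) (hgamma1 : gamma < 1)
    (hA2 : exists s, (2 <= #|A s|)%N)
    (omit : forall s : 'I_n, A s -> 'I_n) :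
  (lebesgue_tuple R #|free_param A|).-negligible
    (kernel_coord omit @`
       [set P : kernel_family R A |
         [/\ is_kernel P, positive_kernel P & not_tr_identified gamma P]]).
Proof.
have gamma_ge0 := ltW hgamma0.
have pi0 s : A s by have /card_gt0P/sigW[] := hA s.
have [s0 /card_gt1P[a [b [_ _ ab]]]] := hA2.
pose pi := dfwith pi0 s0 a.
have bpi : b != pi s0 by rewrite /pi dfwithin eq_sym.
apply: (@negligibleS _ _ _ _
  (\big[setU/set0]_c degenerate_coord omit gamma pi b c)); last first.
  elim/big_ind : _ => [|B C|c _]; [exact: negligible_set0|exact: negligibleU|].
  apply/negligibleP; first exact: measurable_degenerate_coord.
  exact: degenerate_coord_null.
move=> _ [P [kP _ [Q [kQ QP equivQP]]] <-].
have equivPQ : tr_equiv gamma P Q by move=> r s; rewrite equivQP.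
(* Were all weights nonzero, every row of [Q] would equal that of [P]. *)
have [s w0] : exists s, gap_weight gamma pi b P s = 0.
  apply: contrapT => nw; apply: QP.
  apply/functional_extensionality_dep => s; apply/funext => d.
  have [two|one] := ltnP 1 #|A s|.
    have [e ed] : exists e : A s, d != e.
      have /card_gt0P[e ed] : (0 < #|predC1 d|)%N by rewrite cardC1 -ltnS prednK.
      by exists e; rewrite eq_sym.
    (* Here [d] plays the part of [b], against a policy choosing [e] at [s]. *)
    apply: (@row_eq_of_tr_equiv _ _ _ gamma _ _ (dfwith pi0 s e)) => //.
    by rewrite dfwithin.
  have /fintype_le1P/(_ (pi s))/(_ d) -> := one.
  apply: (@other_row_eq_of_tr_equiv _ _ _ gamma _ _ _ _ b) => //.
  by apply/eqP => w0; apply: nw; exists s.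
(* Comparing with the omitted state forces [y] to be a free entry of the row of [b]. *)
have [y ay] := @adj_bellman_mx_col_nonconstant _ _ _ gamma gamma_ge0 hgamma1 P pi s (omit s0 b) kP hn.
have [j yj|yom] := unliftP (omit s0 b) y; last by rewrite yom eqxx in ay.
rewrite -classical_sets.bigcup_seq; exists (s, j); rewrite /= ?mem_index_enum //.
rewrite /degenerate_coord /= kernel_of_coordK // -yj; split=> //.
exact: scaled_weight_eq0.
Qed.
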